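(* For any non-degenerate triangle with side lengths $a,b,c$ and respective medians $m_a,m_b,m_c$, the following inequality holds: \[ \sqrt{bc}\, m_a+ \sqrt{ac}\, m_b+\sqrt{ab}\, m_c \;\geq\; a\, m_a+ b\, m_b+c\, m_c . \]
   Context: $m_a$ denotes the length of the median to the side of length $a$, so $m_a=\tfrac12\sqrt{2b^2+2c^2-a^2}$; similarly $m_b=\tfrac12\sqrt{2a^2+2c^2-b^2}$ and $m_c=\tfrac12\sqrt{2a^2+2b^2-c^2}$. Positive reals $a,b,c$ are the sides of a non-degenerate triangle iff $a+b>c$, $b+c>a$, $a+c>b$. *)

(* Defs.v *)
From Stdlib Require Import Reals Lra.
Open Scope R_scope.

Definition is_triangle (a b c : R) : Prop :=
  0 < a /\ 0 < b /\ 0 < c /\ a + b > c /\ b + c > a /\ a + c > b.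

(* The first argument is the side that the median bisects; the expression is
   symmetric in the other two. *)
Definition median (a b c : R) : R :=
  / 2 * sqrt (2 * b ^ 2 + 2 * c ^ 2 - a ^ 2).

(* Apollonius: the formula is the distance from the vertex A to the midpoint
   of BC. *)
Lemma median_dist_midpoint (xA yA xB yB xC yC : R) :
  median (dist_euc xB yB xC yC) (dist_euc xC yC xA yA) (dist_euc xA yA xB yB)
  = dist_euc xA yA ((xB + xC) / 2) ((yB + yC) / 2).
Proof.
  assert (D : forall x0 y0 x1 y1,
      dist_euc x0 y0 x1 y1 ^ 2 = (x0 - x1) ^ 2 + (y0 - y1) ^ 2).
  { intros; unfold dist_euc; rewrite pow2_sqrt;
      [unfold Rsqr; ring | apply Rplus_le_le_0_compat; apply Rle_0_sqr]. }
  unfold median; rewrite !D.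
  replace (2 * ((xC - xA) ^ 2 + (yC - yA) ^ 2)
           + 2 * ((xA - xB) ^ 2 + (yA - yB) ^ 2)
           - ((xB - xC) ^ 2 + (yB - yC) ^ 2))
    with (2 ^ 2 * (Rsqr (xA - (xB + xC) / 2) + Rsqr (yA - (yB + yC) / 2)))
    by (unfold Rsqr; field).
  rewrite sqrt_mult by (lra || apply Rplus_le_le_0_compat; apply Rle_0_sqr).
  rewrite sqrt_pow2 by lra.
  unfold dist_euc; field.
Qed.

(* Main.v *)
(** With [a = x^2], [b = y^2], [c = z^2] the claim reads
    [sum (x^2 - y z) m_a <= 0].  Since
    [2 (x^2 - y z) = (x - y) (x + z) + (x - z) (x + y)], twice the sum is the sum
    over the pairs of sides of [(x - y) ((x + z) m_a - (y + z) m_b)], and each of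
    these terms is nonpositive: when [x >= y], squaring reduces
    [(x + z) m_a <= (y + z) m_b] to a polynomial inequality that follows from
    [z^2 <= x^2 + y^2]. *)

Require Import Defs.
From Stdlib Require Import Reals Lra Psatz.
Open Scope R_scope.

Lemma median_sym (a b c : R) : median a b c = median a c b.
Proof. unfold median; do 2 f_equal; ring. Qed.

(** Swapping [x] and [y] exchanges the two sides, so their difference is [x - y] times a cofactor
    symmetric in [x] and [y]. Written in [s], [p], [w], the cofactor is nonnegative once
    [z ^ 2 <= s]. *)
Lemma weighted_median_sq_le (x y z : R) :
  0 < y -> y <= x -> 0 < z -> z ^ 2 <= x ^ 2 + y ^ 2 ->
  (x + z) ^ 2 * (2 * (y ^ 2) ^ 2 + 2 * (z ^ 2) ^ 2 - (x ^ 2) ^ 2)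
  <= (y + z) ^ 2 * (2 * (x ^ 2) ^ 2 + 2 * (z ^ 2) ^ 2 - (y ^ 2) ^ 2).
Proof.
  intros Hy Hxy Hz Htri.
  set (s := x ^ 2 + y ^ 2) in *; set (p := x * y); set (w := x + y).
  assert (Hw : 0 < w) by (unfold w; lra).
  assert (Hp : 0 < p) by (unfold p; nra).
  assert (Hs : 0 < s) by (unfold s; nra).
  assert (Hws : w ^ 2 = s + 2 * p) by (unfold w, s, p; ring).
  (* This is [2 * z * sqrt s <= z ^ 2 + s] combined with [sqrt s <= w]; the case split avoids the
     root. *)
  assert (Hamgm : 2 * z * s <= w * (z ^ 2 + s)).
  { destruct (Rle_or_lt (2 * z) w) as [Hzw | Hzw].
    - assert (0 <= (w - 2 * z) * s) by (apply Rmult_le_pos; lra).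
      assert (0 <= w * z ^ 2) by (apply Rmult_le_pos; nra).
      lra.
    - assert (0 <= w * (w - z) ^ 2) by (apply Rmult_le_pos; nra).
      assert (0 <= (2 * z - w) * (w ^ 2 - s)) by (apply Rmult_le_pos; lra).
      lra. }
  assert (Hquot :
    2 * z ^ 4 * (w + 2 * z)
    <= 3 * z ^ 2 * (w * s) + 2 * z * (s ^ 2 + 3 * p * s + p ^ 2)
       + w * (s ^ 2 + p ^ 2)).
  (* The five terms add up exactly to right side minus left side. The second spends [4 * z * s ^ 2]
     where only [2 * z * s ^ 2] is available; the multiple of [Hamgm] repays the excess. *)
  { assert (0 <= 2 * w * z ^ 2 * (s - z ^ 2))
      by (repeat apply Rmult_le_pos; nra).
    assert (0 <= 4 * z * ((s - z ^ 2) * (s + z ^ 2)))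
      by (repeat apply Rmult_le_pos; nra).
    assert (0 <= s * (w * (z ^ 2 + s) - 2 * z * s))
      by (apply Rmult_le_pos; lra).
    assert (0 <= z * (6 * (p * s) + 2 * p ^ 2)) by (apply Rmult_le_pos; nra).
    assert (0 <= w * p ^ 2) by (apply Rmult_le_pos; nra).
    lra. }
  apply Rge_le, Rminus_ge, Rle_ge.
  replace (_ - _) with
    ((x - y) * (3 * z ^ 2 * (w * s) + 2 * z * (s ^ 2 + 3 * p * s + p ^ 2)
       + w * (s ^ 2 + p ^ 2) - 2 * z ^ 4 * (w + 2 * z)))
    by (unfold w, s, p; ring).
  apply Rmult_le_pos; lra.
Qed.

Lemma weighted_median_le (x y z : R) :
  0 < y -> y <= x -> 0 < z -> z ^ 2 <= x ^ 2 + y ^ 2 ->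
  (x + z) * median (x ^ 2) (y ^ 2) (z ^ 2)
  <= (y + z) * median (y ^ 2) (x ^ 2) (z ^ 2).
Proof.
  intros Hy Hxy Hz Htri.
  pose proof (sqrt_le_1_alt _ _ (weighted_median_sq_le x y z Hy Hxy Hz Htri)) as H.
  rewrite !sqrt_mult_alt, !sqrt_pow2 in H by (lra || apply pow2_ge_0).
  unfold median; lra.
Qed.

(** Swapping [x] and [y] negates both factors, so the case [y <= x] settles the other one. *)
Lemma pair_term_nonpos (x y z : R) :
  0 < x -> 0 < y -> 0 < z -> z ^ 2 <= x ^ 2 + y ^ 2 ->
  (x - y) * ((x + z) * median (x ^ 2) (y ^ 2) (z ^ 2)
             - (y + z) * median (y ^ 2) (x ^ 2) (z ^ 2)) <= 0.
Proof.
  intros Hx Hy Hz Htri.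
  destruct (Rle_or_lt y x) as [Hyx | Hxy].
  - pose proof (weighted_median_le x y z Hy Hyx Hz Htri); nra.
  - assert (Htri' : z ^ 2 <= y ^ 2 + x ^ 2) by lra.
    pose proof (weighted_median_le y x z Hx (Rlt_le _ _ Hxy) Hz Htri'); nra.
Qed.

Theorem theorem1 (a b c : R) (habc : is_triangle a b c) :
  sqrt (b * c) * median a b c + sqrt (a * c) * median b a c
    + sqrt (a * b) * median c a b
  >= a * median a b c + b * median b a c + c * median c a b.
Proof.
  destruct habc as (Ha & Hb & Hc & Hab & Hbc & Hac).
  rewrite !sqrt_mult by lra.
  pose proof (sqrt_lt_R0 a Ha) as Hx.
  pose proof (sqrt_lt_R0 b Hb) as Hy.
  pose proof (sqrt_lt_R0 c Hc) as Hz.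
  pose proof (pow2_sqrt a (Rlt_le _ _ Ha)) as Ea.
  pose proof (pow2_sqrt b (Rlt_le _ _ Hb)) as Eb.
  pose proof (pow2_sqrt c (Rlt_le _ _ Hc)) as Ec.
  pose proof (pair_term_nonpos (sqrt a) (sqrt b) (sqrt c) Hx Hy Hz) as Pab.
  pose proof (pair_term_nonpos (sqrt b) (sqrt c) (sqrt a) Hy Hz Hx) as Pbc.
  pose proof (pair_term_nonpos (sqrt a) (sqrt c) (sqrt b) Hx Hz Hy) as Pac.
  rewrite Ea, Eb, Ec in Pab, Pbc, Pac.
  specialize (Pab ltac:(lra)); specialize (Pbc ltac:(lra));
    specialize (Pac ltac:(lra)).
  rewrite (median_sym b c a), (median_sym c b a) in Pbc.
  rewrite (median_sym a c b) in Pac.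
  (* With every product expressed in the roots and the medians, the goal is half the sum of [Pab],
     [Pbc] and [Pac], which is linear in the monomials. *)
  assert (Fa : a * median a b c = sqrt a ^ 2 * median a b c) by now rewrite Ea.
  assert (Fb : b * median b a c = sqrt b ^ 2 * median b a c) by now rewrite Eb.
  assert (Fc : c * median c a b = sqrt c ^ 2 * median c a b) by now rewrite Ec.
  lra.
Qed.
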